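(* Let $n\ge 3$ be an integer, let $f(x)=f_0+f_1x+f_2x^2$ and $g(x)=g_0+g_1x+\cdots+g_nx^n$ be generic polynomials (all $f_i,g_j$ are independent indeterminates), and let $A_n$ be the integer defined in the context. The coefficient of highest absolute value in the expansion of $\mathrm{Res}(f_0+f_1x+f_2x^2,\,g)$ as a polynomial in the variables $f_i,g_j$ is the coefficient corresponding to the monomial $g_0g_nf_0^{A_n}f_1^{n-2A_n}f_2^{A_n}$. Moreover, $$H\big(\mathrm{Res}(f_0+f_1x+f_2x^2,\,g)\big)=H\big(\mathrm{Res}(f_0+f_1x+f_2x^2,\,g_0+g_nx^n)\big)=n\,\frac{(n-A_n-1)!}{(n-2A_n)!\,A_n!}.$$
   Context: For $f=f_0+\cdots+f_mx^m$ and $g=g_0+\cdots+g_nx^n$ with indeterminate coefficients, $\mathrm{Res}(f,g)$ is the Sylvester resultant: the determinant of the $(m+n)\times(m+n)$ matrix whose first $n$ columns are successive downward shifts of the coefficient vector of $f$ (for $1\le j\le n$, column $j$ has entry $f_i$ in row $i+j$, $0\le i\le m$, and zeros elsewhere) and whose last $m$ columns are successive downward shifts of the coefficient vector of $g$ (for $1\le j\le m$, column $n+j$ has entry $g_i$ in row $i+j$, $0\le i\le n$, and zeros elsewhere). It is a polynomial with integer coefficients in the variables $f_i,g_j$. $\mathrm{Res}(f,g_0+g_nx^n)$ denotes the resultant with $g_1=\cdots=g_{n-1}=0$, where $g$ is still regarded as having degree $n$. The (absolute) height of a polynomial $P=\sum_\alpha c_\alpha U^\alpha\in\mathbb{C}[U_1,\dots,U_p]$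 is $H(P)=\max_\alpha|c_\alpha|$. For $n\ge 3$ let $p_n(z)=(n-2z+1)(n-2z+2)-z(n-z)$, a quadratic polynomial in $z$ with $p_n(0)>0$ and $p_n(n/2)<0$. Let $r_n$ be the unique root of $p_n$ in $[0,n/2]$ and set $A_n=\lfloor r_n\rfloor$. (One has $A_n<n/2$.) *)

(* Defs.v *)
From HB Require Import structures.
From mathcomp Require Import all_boot all_order all_algebra.
From mathcomp Require Import mpoly ring lra.

Set Implicit Arguments.
Unset Strict Implicit.
Unset Printing Implicit Defensive.

Import Order.TTheory GRing.Theory Num.Theory.
Local Open Scope ring_scope.

(* The indeterminates are ordered f_0, f_1, f_2, g_0, ..., g_n. *)
Definition fvar (n : nat) (i : 'I_3) : 'I_(3 + n.+1) := lshift n.+1 i.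
Definition gvar (n : nat) (j : 'I_n.+1) : 'I_(3 + n.+1) := rshift 3 j.

Definition generic_f (n : nat) : {poly {mpoly int[3 + n.+1]}} :=
  \sum_(i < 3) 'X_(fvar n i) *: 'X^i.

Definition generic_g (n : nat) : {poly {mpoly int[3 + n.+1]}} :=
  \sum_(j < n.+1) 'X_(gvar j) *: 'X^j.

Definition generic_g_binomial (n : nat) : {poly {mpoly int[3 + n.+1]}} :=
  ('X_(gvar (@ord0 n)))%:P + 'X_(gvar (@ord_max n)) *: 'X^n.

(* [resultant] works with actual degrees. They agree with the formal degrees 2
   and n by the [size_generic_*] lemmas below, and [resultant_colE] identifies
   [resultant] with the determinant of the matrix of shifted columns. *)
Definition res_f_g (n : nat) : {mpoly int[3 + n.+1]} :=
  resultant (generic_f n) (generic_g n).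

Definition res_f_g_binomial (n : nat) : {mpoly int[3 + n.+1]} :=
  resultant (generic_f n) (generic_g_binomial n).

Definition height (R : numDomainType) (k : nat) (P : {mpoly R[k]}) : R :=
  \big[Num.max/0]_(u <- msupp P) `|P@_u|.

(* g_0 g_n f_0^a f_1^(n-2a) f_2^a *)
Definition main_monom (n a : nat) : 'X_{1..3 + n.+1} :=
  (U_(gvar (@ord0 n)) + U_(gvar (@ord_max n))
   + U_(fvar n (inord 0)) *+ a
   + U_(fvar n (inord 1)) *+ (n - a.*2)
   + U_(fvar n (inord 2)) *+ a)%MM.

Definition p_poly (R : nzRingType) (n : nat) : {poly R} :=
  (n%:R - 2%:R * 'X + 1) * (n%:R - 2%:R * 'X + 2%:R) - 'X * (n%:R - 'X).

Lemma p_polyE (R : comNzRingType) (n : nat) (z : R) :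
  (p_poly R n).[z] =
  (n%:R - 2%:R * z + 1) * (n%:R - 2%:R * z + 2%:R) - z * (n%:R - z).
Proof. by rewrite /p_poly -!polyC_natr !hornerE. Qed.

Lemma r_exists (R : rcfType) (n : nat) (hn : (3 <= n)%N) :
  exists z : R, (0 <= z <= n%:R / 2%:R) && root (p_poly R n) z.
Proof.
have n3 : (3%:R : R) <= n%:R by rewrite ler_nat.
have n0 : (0 : R) <= n%:R / 2%:R by lra.
have [|z zI rz] := poly_ivt (p := - p_poly R n) n0.
  by rewrite !hornerN !p_polyE; apply/andP; split; nra.
by exists z; rewrite -rootN rz andbT.
Qed.

Lemma r_unique (R : rcfType) (n : nat) (y z : R) :
  (0 <= y <= n%:R / 2%:R) && root (p_poly R n) y ->
  (0 <= z <= n%:R / 2%:R) && root (p_poly R n) z -> y = z.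
Proof.
case/andP=> /andP[y0 yn] /rootP; rewrite p_polyE => py.
case/andP=> /andP[z0 zn] /rootP; rewrite p_polyE => pz.
have : (y - z) * (5%:R * (y + z) - (5%:R * n%:R + 6%:R)) = 0 :> R.
  by rewrite -[RHS](subrr 0) -{1}py -pz; ring.
move/eqP; rewrite mulf_eq0 => /orP[|/eqP h]; first by rewrite subr_eq0 => /eqP.
by exfalso; lra.
Qed.

Definition r_ (R : rcfType) (n : nat) (hn : (3 <= n)%N) : R :=
  xchoose (r_exists R hn).

Definition A_ (R : archiRcfType) (n : nat) (hn : (3 <= n)%N) : nat :=
  Num.truncn (r_ R hn).

Lemma A_floor (R : archiRcfType) (n : nat) (hn : (3 <= n)%N) :
  (A_ R hn)%:Z = Num.floor (r_ R hn).
Proof.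
have /andP[/andP[r0 _] _] := xchooseP (r_exists R hn).
by rewrite /A_ truncn_floor r0 gez0_abs // floor_ge0.
Qed.

Section Sizes.
Variable n : nat.

Local Lemma mpolyX_neq0 (i : 'I_(3 + n.+1)) : 'X_i != 0 :> {mpoly int[3 + n.+1]}.
Proof. by rewrite -msupp_eq0 msuppX. Qed.

Local Lemma size_sumXn d (c : 'I_d.+1 -> {mpoly int[3 + n.+1]}) :
  c ord_max != 0 -> size (\sum_(i < d.+1) c i *: 'X^i) = d.+1.
Proof.
move=> c0; rewrite big_ord_recr /= addrC size_polyDl size_scale // size_polyXn //.
rewrite ltnS; apply: (leq_trans (size_sum _ _ _)); apply/bigmax_leqP => i _.
by rewrite (leq_trans (size_scale_leq _ _)) // size_polyXn.
Qed.

Lemma size_generic_f : size (generic_f n) = 3.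
Proof. by rewrite size_sumXn // mpolyX_neq0. Qed.

Lemma size_generic_g : size (generic_g n) = n.+1.
Proof. by rewrite size_sumXn // mpolyX_neq0. Qed.

Lemma size_generic_g_binomial : (0 < n)%N -> size (generic_g_binomial n) = n.+1.
Proof.
move=> n0; rewrite /generic_g_binomial addrC.
rewrite size_polyDl size_scale ?mpolyX_neq0 ?size_polyXn //.
by rewrite (leq_ltn_trans (size_polyC_leq1 _)).
Qed.

End Sizes.

Lemma resultant_colE (R : comNzRingType) (m n : nat) (p q : {poly R}) :
  size p = m.+1 -> size q = n.+1 ->
  resultant p q =
  \det (row_mx (\matrix_(i < n + m, j < n) (p`_(i - j) *+ (j <= i)))
               (\matrix_(i < n + m, j < m) (q`_(i - j) *+ (j <= i)))).
Proof.
move=> sp sq; have <- : (size p).-1 = m by rewrite sp.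
have <- : (size q).-1 = n by rewrite sq.
rewrite /resultant -det_tr; congr (\det _); apply/matrixP=> i j.
by rewrite mxE Sylvester_mxE mxE; case: (split j) => k; rewrite mxE.
Qed.

(* Main.v *)
(* Write f = f_2 (x - r)(x - s), so that Res(f, g) = f_2^n g(r) g(s).  The
   coefficient of g_i g_j (i < j) is f_0^i f_2^(n-j) times
   f_2^(j-i) (r^(j-i) + s^(j-i)), a Lucas polynomial in -f_1 and f_0 f_2, whose
   coefficients are up to sign the numbers
   L(d,k) = d (d-k-1)! / ((d-2k)! k!) with d = j - i; the coefficient of g_i^2
   is f_0^i f_2^(n-i).  All the resulting monomials are distinct.  L(d,k) grows
   with d because L(d+2,k) = L(d+1,k) + L(d,k-1), and
   L(n,k) <= L(n,k+1) iff p_n(k+1) >= 0 iff k+1 <= r_n.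
   The roots r, s are avoided: the determinant D(p,q) of the rows
   f, xf, ..., x^(n-1) f, p, q is bilinear, alternating and kills x^k f (k < n),
   so D(x^i, x^j) satisfies a linear recurrence in j, and
   Res(f, g) = D(g, xg). *)
Require Import Defs.
From mathcomp Require Import all_boot all_order all_algebra.
From mathcomp Require Import mpoly ring lra zify.

Set Implicit Arguments.
Unset Strict Implicit.
Unset Printing Implicit Defensive.

Import Order.TTheory GRing.Theory Num.Theory.
Local Open Scope ring_scope.

(* The Lucas sequences of the roots u, v of X^2 - sX + t: (x0, x1) = (0, 1) gives
   (u^d - v^d) / (u - v) and (x0, x1) = (2, s) gives u^d + v^d. *)
Fixpoint lucas_seq (R : pzRingType) (x0 x1 s t : R) (d : nat) : R :=
  match d with
  | 0 => x0
  | d'.+1 => match d' with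
             | 0 => x1
             | d''.+1 => s * lucas_seq x0 x1 s t d' - t * lucas_seq x0 x1 s t d''
             end
  end.

Lemma lucas_seqSS (R : pzRingType) (x0 x1 s t : R) d :
  lucas_seq x0 x1 s t d.+2 =
  s * lucas_seq x0 x1 s t d.+1 - t * lucas_seq x0 x1 s t d.
Proof. by []. Qed.

Lemma nat_ind2 (P : nat -> Prop) :
  P 0 -> P 1 -> (forall d, P d -> P d.+1 -> P d.+2) -> forall d, P d.
Proof.
move=> P0 P1 PS d; suff [] : P d /\ P d.+1 by [].
by elim: d => // d [/PS]; auto.
Qed.

(** With u + v = s and uv = t, this is (u^(d+2) - v^(d+2)) - uv (u^d - v^d) = (u - v)(u^(d+1) +
    v^(d+1)) divided by u - v. *)
Lemma lucas_seq_VU (R : comPzRingType) (s t : R) d :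
  lucas_seq 0 1 s t d.+2 - t * lucas_seq 0 1 s t d = lucas_seq 2 s s t d.+1.
Proof.
elim/nat_ind2: d => [||d IH0 IH1].
- by rewrite /=; ring.
- by rewrite /=; ring.
by rewrite (lucas_seqSS 2) -IH0 -IH1 (lucas_seqSS 0 1 s t d.+2)
  (lucas_seqSS 0 1 s t d); ring.
Qed.

(** * The resultant with a quadratic polynomial as a quadratic form *)

Section ShiftDeterminant.
Variables (R : idomainType) (n : nat) (f : {poly R}).
Hypothesis sf : (size f <= 3)%N.
Local Notation a := f`_0.
Local Notation b := f`_1.
Local Notation c := f`_2.

Definition shift_row (p q : {poly R}) (i : nat) : {poly R} :=
  if (i < n)%N then 'X^i * f else if i == n then p else q.

Definition shift_det (p q : {poly R}) : R :=
  \det (\matrix_(i < n + 2, j < n + 2) (shift_row p q i)`_j).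

Lemma shift_det_linl k p1 p2 q :
  shift_det (k *: p1 + p2) q = k * shift_det p1 q + shift_det p2 q.
Proof.
have hn : (n < n + 2)%N by lia.
have lift_n i : (lift (Ordinal hn) i == n :> nat) = false.
  by have := neq_lift (Ordinal hn) i; rewrite eq_sym -val_eqE => /negbTE.
rewrite -[X in _ = _ + X]mul1r.
apply: (@determinant_multilinear _ _ _ _ _ (Ordinal hn)).
- by apply/rowP => j; rewrite !mxE /= /shift_row ltnn eqxx coefD coefZ mul1r.
- by apply/matrixP => i j; rewrite !mxE /shift_row lift_n.
by apply/matrixP => i j; rewrite !mxE /shift_row lift_n.
Qed.

Lemma shift_detpp p : shift_det p p = 0.
Proof.
have hn : (n < n + 2)%N by lia.
have hn1 : (n.+1 < n + 2)%N by lia.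
apply: (@determinant_alternate _ _ _ (Ordinal hn) (Ordinal hn1)) => [|j].
  by rewrite -val_eqE /=; lia.
by rewrite !mxE /shift_row /= ltnn eqxx ltnNge leqnSn /=; case: ifP.
Qed.

(** Row k of the matrix is already ['X^k * f], so two rows coincide. *)
Lemma shift_det_mulf p k : (k < n)%N -> shift_det ('X^k * f) p = 0.
Proof.
move=> kn; have hn : (n < n + 2)%N by lia.
have hk : (k < n + 2)%N by lia.
apply: (@determinant_alternate _ _ _ (Ordinal hk) (Ordinal hn)) => [|j].
  by rewrite -val_eqE /=; lia.
by rewrite !mxE /shift_row /= kn ltnn eqxx.
Qed.

Lemma shift_detDl p1 p2 q : shift_det (p1 + p2) q = shift_det p1 q + shift_det p2 q.
Proof. by rewrite -[p1]scale1r shift_det_linl mul1r scale1r. Qed.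

Lemma shift_det_anti p q : shift_det p q = - shift_det q p.
Proof.
(* Polarizing D(p + q, p + q) = 0 also needs additivity in the last row. *)
have flip r1 r2 s : shift_det s (r1 + r2) = shift_det s r1 + shift_det s r2.
  have h1 : (n.+1 < n + 2)%N by lia.
  rewrite -[shift_det s r1]mul1r -[shift_det s r2]mul1r.
  apply: (@determinant_multilinear _ _ _ _ _ (Ordinal h1)).
  - apply/rowP => j; rewrite !mxE /= /shift_row ltnNge leqnSn /=.
    by rewrite (_ : _ == _ = false) ?coefD ?mul1r //; lia.
  - apply/matrixP => i j; rewrite !mxE /shift_row; case: ifP => // h.
    case: ifP => // h'; case/negP: (neq_lift (Ordinal h1) i).
    by rewrite -val_eqE; move: (ltn_ord (lift (Ordinal h1) i)) h h' => /=; lia.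
  apply/matrixP => i j; rewrite !mxE /shift_row; case: ifP => // h.
  case: ifP => // h'; case/negP: (neq_lift (Ordinal h1) i).
  by rewrite -val_eqE; move: (ltn_ord (lift (Ordinal h1) i)) h h' => /=; lia.
apply/eqP; rewrite -addr_eq0; apply/eqP.
by have := shift_detpp (p + q); rewrite shift_detDl !flip !shift_detpp add0r addr0.
Qed.

Lemma shift_det0l q : shift_det 0 q = 0.
Proof.
by apply: (addrI (shift_det 0 q)); rewrite -shift_detDl !addr0.
Qed.

Lemma shift_detZl k p q : shift_det (k *: p) q = k * shift_det p q.
Proof. by rewrite -[k *: p]addr0 shift_det_linl shift_det0l addr0. Qed.

Lemma shift_det_suml m (k : 'I_m -> R) (p : 'I_m -> {poly R}) q :
  shift_det (\sum_i k i *: p i) q = \sum_i k i * shift_det (p i) q.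
Proof.
by elim/big_rec2: _ => [|i r s _ <-]; rewrite ?shift_det0l // shift_det_linl.
Qed.

Lemma shift_det_sumr m (k : 'I_m -> R) (q : 'I_m -> {poly R}) p :
  shift_det p (\sum_i k i *: q i) = \sum_i k i * shift_det p (q i).
Proof.
rewrite shift_det_anti shift_det_suml -sumrN.
by apply: eq_bigr => i _; rewrite -mulrN -shift_det_anti.
Qed.

Local Notation x i j := (shift_det 'X^i 'X^j).

(** Expand D(x^k f, x^i) = 0 by linearity and exchange the arguments. *)
Lemma shift_det_rec i k : (k < n)%N -> c * x i k.+2 = - b * x i k.+1 - a * x i k.
Proof.
move=> kn; have := shift_det_mulf 'X^i kn.
have -> : 'X^k * f = a *: 'X^k + b *: 'X^(k.+1) + c *: 'X^(k.+2).
  rewrite [in LHS](_ : f = a%:P + b *: 'X + c *: 'X^2); last first.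
    apply/polyP => j; rewrite !coefD coefC !coefZ coefX coefXn.
    case: j => [|[|[|j]]] /=; rewrite ?mulr0 ?mulr1 ?addr0 ?add0r //.
    by rewrite nth_default // (leq_trans sf).
  rewrite !mulrDr -!scalerAr -exprSr -exprD addn2.
  by congr (_ + _ + _); rewrite mulrC mul_polyC.
rewrite !shift_detDl !shift_detZl !(shift_det_anti _ 'X^i) => h.
by apply/eqP; rewrite -subr_eq0 -oppr_eq0; apply/eqP; rewrite -[RHS]h; ring.
Qed.

(** Row i has no coefficient below x^i, so the matrix is triangular with diagonal a, ..., a, 1,
    1. *)
Lemma shift_det_top : x n n.+1 = a ^+ n.
Proof.
rewrite /shift_det -det_tr det_trig; last first.
  apply/is_trig_mxP => i j ij; rewrite !mxE /shift_row.
  case: ifP => h; first by rewrite coefXnM ij.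
  case: ifP => h'; rewrite coefXn.
    by rewrite (_ : _ == _ = false) //; move/eqP: h'; lia.
  by rewrite (_ : _ == _ = false) //; move: (ltn_ord j); lia.
rewrite big_split_ord /= (eq_bigr (fun=> a)) => [|i _]; last first.
  by rewrite !mxE /shift_row /= ltn_ord coefXnM ltnn subnn.
rewrite prodr_const card_ord big1 ?mulr1 // => i _.
rewrite !mxE /shift_row /= ltnNge leq_addr /=.
by case: ifP => h; rewrite coefXn; case: i h => [[|[|//]]] /= _;
  rewrite ?addn0 ?addn1 ?eqxx //; lia.
Qed.

Hypotheses (a0 : a != 0) (c0 : c != 0).

(** As D(x^(i+1), x^(i+1)) = 0, the recurrence gives a D(x^i, x^(i+1)) = c D(x^(i+1), x^(i+2)),
    which is iterated up to i = n. *)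
Lemma shift_det_adj i e : (i + e)%N = n -> x i i.+1 = a ^+ i * c ^+ e.
Proof.
(* With the factor a^e the right side becomes a^n c^e, and the induction needs no division by a. *)
move=> ien; apply: (@mulfI _ (a ^+ e)); first by rewrite expf_neq0.
rewrite mulrA -exprD addnC ien.
elim: e i ien => [|e IH] i ien.
  by move: ien; rewrite addn0 => ->; rewrite shift_det_top mul1r mulr1.
have := IH i.+1; rewrite addSnnS => /(_ ien) h.
have := @shift_det_rec i.+1 i; rewrite shift_detpp mulr0 sub0r.
rewrite (shift_det_anti 'X^(i.+1) 'X^i) mulrN opprK => r.
rewrite exprSr -mulrA -r; last by lia.
by rewrite mulrCA h exprS; ring.
Qed.

(** The recurrence in j has leading coefficient c. The power c^e, with e dropping as d grows,
    absorbs it and leaves the monic recurrence whose roots are c times those of f: sum -b, product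
    ac. *)
Lemma shift_detE i d e : (i + d + e)%N = n.+1 -> (i <= n)%N ->
  x i (i + d) = a ^+ i * c ^+ e * lucas_seq 0 1 (- b) (a * c) d.
Proof.
move=> + ilen; elim/nat_ind2: d e => [||d IH0 IH1] e ide.
- by rewrite addn0 shift_detpp mulr0.
- by rewrite addn1 mulr1; apply: shift_det_adj; lia.
apply: (mulfI c0); rewrite !addnS shift_det_rec; last by lia.
rewrite lucas_seqSS (IH0 e.+2); last by lia.
by rewrite -addnS (IH1 e.+1) ?exprS; [ring|lia].
Qed.

(** This is the total coefficient of q_i q_j, j = i + d + 1, in D(q, xq). Exchanging the arguments
    of the second determinant produces the difference treated in [lucas_seq_VU]. *)
Lemma shift_det_sym i d e : (i + d.+1 + e)%N = n ->
  x i (i + d.+1).+1 + x (i + d.+1) i.+1 =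
  a ^+ i * c ^+ e * lucas_seq 2 (- b) (- b) (a * c) d.+1.
Proof.
move=> ide; rewrite -addnS (@shift_detE i d.+2 e); [|lia|lia].
rewrite shift_det_anti -addSnnS (@shift_detE i.+1 d e.+1); [|lia|lia].
by rewrite -lucas_seq_VU !exprS; ring.
Qed.

Lemma resultant_shift_det (q : {poly R}) : size q = n.+1 ->
  resultant f q = shift_det q ('X * q).
Proof.
move=> sq; rewrite (@resultant_colE _ 2 n) //; last first.
  apply/eqP; rewrite eqn_leq sf /= ltnNge; apply: contra c0 => h.
  by rewrite nth_default.
rewrite /shift_det -[RHS]det_tr; congr (\det _); apply/matrixP => i j.
rewrite [RHS]mxE [RHS]mxE -(splitK j).
case: (split j) => k /=; rewrite ?row_mxEl ?row_mxEr mxE /shift_row /=.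
  by rewrite ltn_ord coefXnM leqNgt; case: ltnP.
rewrite ltnNge leq_addr /=; case: k => [[|[|//]]] /= _.
  by rewrite addn0 eqxx subn0.
rewrite (_ : _ == _ = false) ?coefXM; last by lia.
by case: (nat_of_ord i) => // m; rewrite subn1.
Qed.

(** The value at 0 is 1 and not 2: q_i^2 arises from one ordered pair of indices, q_i q_j with i < j
    from two. *)
Definition quad_coef (d : nat) : R :=
  if d is 0 then 1 else lucas_seq 2 (- b) (- b) (a * c) d.

Lemma resultant_quad (q : {poly R}) : size q = n.+1 ->
  resultant f q = \sum_(i < n.+1) \sum_(j < n.+1 | (i <= j)%N)
    q`_i * q`_j * (a ^+ i * c ^+ (n - j) * quad_coef (j - i)).
Proof.
move=> sq; rewrite resultant_shift_det //.
have q_sum : q = \sum_(i < n.+1) q`_i *: 'X^i.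
  by rewrite -poly_def -sq coefK.
have {1}-> : 'X * q = \sum_(i < n.+1) q`_i *: 'X^(i.+1).
  rewrite {1}q_sum mulr_sumr; apply: eq_bigr => i _.
  by rewrite -scalerAr -exprS.
rewrite {1}q_sum shift_det_suml.
under eq_bigr => i _ do rewrite shift_det_sumr mulr_sumr
  (bigID (fun j : 'I_n.+1 => (i <= j)%N)) /=.
(* The pairs with j < i are transposed, so that (i, j) and (j, i) meet in one term; then the
   diagonal is split off. *)
rewrite big_split /= [X in _ + X](exchange_big_dep predT) //= -big_split /=.
apply: eq_bigr => i _; rewrite (bigD1 i) //= [in RHS](bigD1 i) //= -addrA.
congr (_ + _).
  rewrite subnn mulr1 (@shift_det_adj i (n - i)) ?mulrA //.
  by move: (ltn_ord i); lia.
have lt_neq (j : 'I_n.+1) : (i < j)%N = (i <= j)%N && (j != i).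
  by rewrite -val_eqE ltn_neqAle eq_sym andbC.
rewrite [X in _ + X](eq_bigl (fun j : 'I_n.+1 => (i <= j)%N && (j != i)));
  last by move=> j; rewrite -lt_neq ltnNge.
rewrite -big_split /=; apply: eq_bigr => j /andP[ij nij].
have [d dE] : exists d, (j = i + d.+1 :> nat)%N.
  by exists (j - i).-1; move: nij ij; rewrite -val_eqE /=; lia.
have := @shift_det_sym i d (n - j); rewrite -dE => /(_ _) h.
rewrite [quad_coef _](_ : _ = lucas_seq 2 (- b) (- b) (a * c) d.+1); last first.
  by rewrite dE addKn.
rewrite -h; last by move: (ltn_ord j); lia.
by ring.
Qed.

End ShiftDeterminant.

(** * The numbers L(d, k): closed form, growth in d, ratio in k *)

Fixpoint lucas_num (d k : nat) : nat :=
  match d with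
  | 0 => if k is 0 then 2 else 0
  | d'.+1 => match d' with
             | 0 => if k is 0 then 1 else 0
             | d''.+1 => lucas_num d' k + (if k is k'.+1 then lucas_num d'' k' else 0)
             end
  end%N.

Lemma lucas_numSS d k : lucas_num d.+2 k =
  (lucas_num d.+1 k + (if k is k'.+1 then lucas_num d k' else 0))%N.
Proof. by []. Qed.

Lemma lucas_num_gt d k : (d < k.*2)%N -> lucas_num d k = 0%N.
Proof.
elim/nat_ind2: d k => [||d IH0 IH1] [|k] // h.
by rewrite lucas_numSS IH1 ?IH0 //; lia.
Qed.

(** The closed form with denominators cleared, by induction along the recurrence. The index d + 1
    leaves out L(0, 0) = 2, where the formula fails. *)
Lemma lucas_num_fact d k : (k.*2 <= d.+1)%N ->
  (lucas_num d.+1 k * (k`! * (d.+1 - k.*2)`!) = d.+1 * (d - k)`!)%N.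
Proof.
elim/nat_ind2: d k => [||d IH0 IH1] [|k] // h.
- by case: k h.
- rewrite lucas_numSS addn0 double0 !subn0 in IH1 *.
  move: (IH1 0%N isT); rewrite double0 !subn0 fact0 !mul1n !factS; nia.
rewrite lucas_numSS.
have h0 : (k.*2 <= d.+1)%N by lia.
have := IH0 k h0.
have [h1|h1] := leqP (k.+1.*2) d.+2.
  have := IH1 _ h1.
  (* This parametrization removes every truncated subtraction. *)
  have [e ->] : exists e, d = (k.*2 + e)%N by exists (d - k.*2)%N; lia.
  have -> : ((k.*2 + e).+2 - k.+1.*2 = e)%N by lia.
  have -> : ((k.*2 + e).+3 - k.+1.*2 = e.+1)%N by lia.
  have -> : ((k.*2 + e).+1 - k.*2 = e.+1)%N by lia.
  have -> : ((k.*2 + e).+1 - k.+1 = k + e)%N by lia.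
  have -> : ((k.*2 + e).+2 - k.+1 = (k + e).+1)%N by lia.
  have -> : ((k.*2 + e) - k = k + e)%N by lia.
  rewrite !factS; move: (lucas_num _ _) (lucas_num _ _) => x y.
  by move: (k`!) (e`!) ((k + e)`!) => F G H; nia.
(* Boundary case d + 3 = 2(k + 1): only the second term of the recurrence survives. *)
rewrite (@lucas_num_gt d.+2) //.
have -> : d = k.*2.-1 by lia.
case: k h h0 h1 => [|k] // _ _ _.
have -> : (k.+1.*2.-1.+1 - k.+1.*2 = 0)%N by lia.
have -> : (k.+1.*2.-1.+3 - k.+2.*2 = 0)%N by lia.
have -> : (k.+1.*2.-1.+2 - k.+2 = k.+1)%N by lia.
have -> : (k.+1.*2.-1 - k.+1 = k)%N by lia.
rewrite !factS fact0; move: (lucas_num _ _) => x.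
by move: (k`!) => F /(congr1 (muln k.+2)); nia.
Qed.

Lemma lucas_num_closed (F : numFieldType) n k : (0 < n)%N -> (k.*2 <= n)%N ->
  (lucas_num n k)%:R = n%:R * ((n - k - 1)`!%:R / ((n - k.*2)`!%:R * k`!%:R)) :> F.
Proof.
case: n => // d _ h; rewrite mulrA; apply: (canRL (mulfK _)).
  by rewrite mulf_neq0 // pnatr_eq0 -lt0n fact_gt0.
rewrite -!natrM [((d.+1 - k.*2)`! * _)%N]mulnC (lucas_num_fact h).
by congr ((_ * _`!)%:R); lia.
Qed.

(** The recurrence adds a natural number at each step. The index 0 is excluded because L(0, 0) = 2 >
    L(1, 0) = 1. *)
Lemma leq_lucas_num d e k :
  (0 < d <= e)%N -> (lucas_num d k <= lucas_num e k)%N.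
Proof.
case: d e => [|d] [|e] // /andP[_]; rewrite ltnS => /subnK <-.
elim: (e - d)%N => // m IH.
by apply: (leq_trans IH); rewrite addSn lucas_numSS leq_addr.
Qed.

(** Quotient of two closed forms. With n = d + 1, the multiplier on the right minus the one on the
    left is p_n(k + 1), which ties the growth in k to the sign of p_n. *)
Lemma lucas_num_ratio d k : (k.+1.*2 <= d.+1)%N ->
  (lucas_num d.+1 k.+1 * ((d - k) * k.+1) =
   lucas_num d.+1 k * ((d.+1 - k.*2) * (d - k.*2)))%N.
Proof.
move=> h; have := lucas_num_fact h.
have := @lucas_num_fact d k; have -> : (k.*2 <= d.+1)%N by lia.
move=> /(_ isT).
have [e ->] : exists e, d = (k.*2.+1 + e)%N by exists (d - k.*2.+1)%N; lia.
have -> : ((k.*2.+1 + e).+1 - k.*2 = e.+2)%N by lia.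
have -> : ((k.*2.+1 + e).+1 - k.+1.*2 = e)%N by lia.
have -> : ((k.*2.+1 + e) - k.*2 = e.+1)%N by lia.
have -> : ((k.*2.+1 + e) - k = (k + e).+1)%N by lia.
have -> : ((k.*2.+1 + e) - k.+1 = k + e)%N by lia.
have := fact_gt0 k; have := fact_gt0 e; rewrite !factS.
move: (lucas_num _ _) (lucas_num _ _) => x y.
move: (k`!) (e`!) ((k + e)`!) => F G H G0 F0 E1 E2.
have FG : (0 < F * G)%N by rewrite muln_gt0 F0.
apply/eqP; rewrite -(eqn_pmul2r FG); apply/eqP; nia.
Qed.

(** * The maximum of L(n, k) over k is attained at A_n *)

Section Maximum.
Variables (R : archiRcfType) (n : nat) (hn : (3 <= n)%N).
Local Notation A := (A_ R hn).

Lemma A_double_le : (A.*2 <= n)%N.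
Proof.
have := xchooseP (r_exists R hn); rewrite -/(r_ R hn).
move=> /andP[/andP[r0 rn] _]; have /andP[Ar _] := truncn_itv r0.
rewrite -(ler_nat R) -muln2 natrM; rewrite -/A in Ar; lra.
Qed.

(** The right side says p_n(z) >= 0, written over the integers to avoid truncated subtraction. *)
Lemma A_geP z : (z.*2 <= n)%N -> (z <= A)%N =
  (z%:Z * (n%:Z - z%:Z) <= (n%:Z - 2 * z%:Z + 1) * (n%:Z - 2 * z%:Z + 2))%R.
Proof.
have := xchooseP (r_exists R hn); rewrite -/(r_ R hn).
move=> /andP[/andP[r0 rn] /rootP]; rewrite p_polyE => pr zn.
rewrite truncn_ge_nat // -(ler_int R) !(rmorphM, rmorphD, rmorphN) /=.
rewrite !rmorph1 !pmulrn -!natz.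
have {}zn : (2 * z%:R <= n%:R :> R) by rewrite -natrM ler_nat; lia.
have n3 : (3%:R : R) <= n%:R by rewrite ler_nat.
rewrite !mulrz_nat; move: (r_ R hn) r0 rn pr => r r0 rn pr.
have z0 : (0 : R) <= z%:R by [].
rewrite -[1 + 1]/2.
(* Since p_n(r) = 0, the difference p_n(z) - p_n(r) factors. The second factor is positive because r
   + z <= n, so the sign is that of r - z. *)
have E : (n%:R - 2 * z%:R + 1) * (n%:R - 2 * z%:R + 2) - z%:R * (n%:R - z%:R) =
  (r - z%:R) * (5%:R * n%:R + 6%:R - 5%:R * (r + z%:R)) :> R.
  by rewrite -[LHS]subr0 -pr; ring.
rewrite -[in LHS]subr_ge0 -[in RHS]subr_ge0 E pmulr_lge0 //; lra.
Qed.

Lemma lucas_num_step_up k : (k < A)%N -> (lucas_num n k <= lucas_num n k.+1)%N.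
Proof.
move=> kA; have h2 := A_double_le.
have h : (k.+1.*2 <= n)%N by lia.
move: (kA); rewrite A_geP // => hp.
case: n hn h hp {kA h2} => // d _ h hp.
have := lucas_num_ratio h.
have : ((d - k) * k.+1 <= (d.+1 - k.*2) * (d - k.*2))%N by move: hp h; clear; nia.
have : (0 < (d - k) * k.+1)%N by rewrite muln_gt0; lia.
move: ((d - k) * _)%N ((d.+1 - _) * _)%N (lucas_num _ _) (lucas_num _ _) => u v x y.
by clear; nia.
Qed.

Lemma lucas_num_step_down k : (A <= k)%N -> (lucas_num n k.+1 <= lucas_num n k)%N.
Proof.
(* Past n/2 the left side is 0; otherwise the ratio identity applies. *)
move=> kA; have [h|h] := leqP (k.+1.*2) n; last by rewrite lucas_num_gt.
have : ~~ (k < A)%N by rewrite -leqNgt.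
rewrite A_geP // -ltNge => hp.
case: n hn h hp {kA} => // d _ h hp.
have := lucas_num_ratio h.
have : ((d.+1 - k.*2) * (d - k.*2) <= (d - k) * k.+1)%N by move: hp h; clear; nia.
have : (0 < (d - k) * k.+1)%N by rewrite muln_gt0; lia.
move: ((d - k) * _)%N ((d.+1 - _) * _)%N (lucas_num _ _) (lucas_num _ _) => u v x y.
by clear; nia.
Qed.

(** Induction on the distance from k to A, on either side. *)
Lemma lucas_num_max k : (lucas_num n k <= lucas_num n A)%N.
Proof.
have [/subnK <-|/ltnW/subnK] := leqP A k.
  elim: (k - A)%N => // m IH; apply: leq_trans IH.
  by rewrite addSn lucas_num_step_down // leq_addl.
move: (A - k)%N => m; elim: m k => [|m IH] k h; first by rewrite -h.
apply: (leq_trans _ (IH k.+1 _)); last by rewrite addnS.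
by apply: lucas_num_step_up; lia.
Qed.

End Maximum.

(** * Expansion of u^d + v^d in s and t *)

(** The bound N does not depend on d, so all the sums in the induction share one range, and the
    resultant can use N = n + 1 for every pair (i, j). *)
Lemma lucas_seq_expand (R : comPzRingType) (s t : R) N d : (d < N)%N ->
  lucas_seq 2 s s t d =
  \sum_(k < N | (k.*2 <= d)%N)
    (-1) ^+ k * (lucas_num d k)%:R * t ^+ k * s ^+ (d - k.*2).
Proof.
move=> dN; rewrite big_mkcond /=.
rewrite (eq_bigr (fun k : 'I_N =>
    (-1) ^+ k * (lucas_num d k)%:R * t ^+ k * s ^+ (d - k.*2))) => [|k _]; last first.
  by case: leqP => // h; rewrite lucas_num_gt // mulr0n mulr0 !mul0r.
case: N dN => // N dN.
elim/nat_ind2: d dN => [||d IH0 IH1] dN.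
- by rewrite big_ord_recl big1 => [|i _] /=; rewrite ?mulr0 ?mul0r; ring.
- by rewrite big_ord_recl big1 => [|i _] /=; rewrite ?mulr0 ?mul0r // ?expr1; ring.
rewrite lucas_seqSS IH1; last by lia.
rewrite IH0; last by lia.
under [RHS]eq_bigr => k _ do rewrite lucas_numSS natrD mulrDr !mulrDl.
rewrite big_split; congr (_ + _).
  rewrite mulr_sumr; apply: eq_bigr => k _.
  (* Past this bound the truncated exponents no longer differ by one, but the coefficient is 0. *)
  have [h|h] := leqP k.*2 d.+1; last first.
    by rewrite lucas_num_gt // mulr0n mulr0 !mul0r mulr0.
  by rewrite (subSn h) exprS; ring.
(* The factor t shifts k by one: the term k = 0 on the right and the term k = N on the left both
   vanish. *)
rewrite [RHS]big_ord_recl big_ord_recr /= [lucas_num d N]lucas_num_gt; last by lia.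
rewrite !mulr0 !mul0r add0r addr0 mulr_sumr -sumrN; apply: eq_bigr => k _.
by rewrite doubleS !subSS !exprS; ring.
Qed.

(** * Heights of linear combinations of distinct monomials *)

Section MonomialSums.
Variables (n : nat) (I : finType) (P : pred I).
Variables (m : I -> 'X_{1..n}) (c : I -> int) (B : int).
Hypotheses (minj : {in P &, injective m}) (B0 : 0 <= B).
Hypothesis cB : forall t, P t -> `|c t| <= B.
Local Notation S := (\sum_(t | P t) c t *: 'X_[m t] : {mpoly int[n]}).

Lemma mcoeff_sum_monom t : P t -> S@_(m t) = c t.
Proof.
move=> Pt; rewrite raddf_sum (bigD1 t) //= mcoeffZ mcoeffX eqxx mulr1.
rewrite big1 ?addr0 // => s /andP[Ps st]; rewrite mcoeffZ mcoeffX.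
by rewrite (inj_in_eq minj) // (negPf st) mulr0.
Qed.

Lemma mcoeff_sum_monom_le u : `|S@_u| <= B.
Proof.
case: (pickP (fun t => P t && (m t == u))) => [t /andP[Pt /eqP <-]|h].
  by rewrite mcoeff_sum_monom // cB.
rewrite raddf_sum big1 ?normr0 // => t Pt /=.
by have := h t; rewrite Pt mcoeffZ mcoeffX /= => ->; rewrite mulr0.
Qed.

Lemma height_sum_monom t : P t -> `|c t| = B -> height S = B.
Proof.
move=> Pt ctB; apply/eqP; rewrite eq_le; apply/andP; split.
  by apply: bigmax_le => // u _; apply: mcoeff_sum_monom_le.
(* Outside the support c t = 0, hence B = 0, and the default value 0 of the maximum suffices. *)
have [h|h] := boolP (m t \in msupp S).
  rewrite -ctB -(mcoeff_sum_monom Pt).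
  exact: (@le_bigmax_seq _ _ _ _ _ _ xpredT (fun u => `|S@_u|) h).
move: h; rewrite mcoeff_msupp negbK mcoeff_sum_monom // => /eqP c0.
by rewrite -ctB c0 normr0; apply: bigmax_ge_id.
Qed.

End MonomialSums.

Lemma coef_sum_ord (R : nzRingType) n (S : {set 'I_n}) (c : 'I_n -> R) (i : 'I_n) :
  (\sum_(j in S) c j *: 'X^j)`_i = if i \in S then c i else 0.
Proof.
rewrite coef_sum big_mkcond (bigD1 i) //= coefZ coefXn eqxx mulr1.
rewrite big1 ?addr0 // => j ji; case: ifP => // _; rewrite coefZ coefXn.
by rewrite (_ : _ == _ = false) ?mulr0 //; apply/negbTE; rewrite eq_sym.
Qed.

(** * The monomial expansion of the resultant *)

Section Monomials.
Variable n : nat.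
Local Notation idx := ('I_n.+1 * 'I_n.+1 * 'I_n.+1)%type.
Local Notation mpolyZ := {mpoly int[3 + n.+1]}.

(* The index (i, j, k) stands for the term of g_i g_j (i <= j) containing
   f_0^i f_2^(n-j) (f_0 f_2)^k f_1^(j-i-2k); for i = j only k = 0 occurs. *)
Definition res_monom (t : idx) : 'X_{1..3 + n.+1} :=
  let: (i, j, k) := t in
  (U_(gvar i) + U_(gvar j)
   + U_(fvar n (inord 0)) *+ (i + k)
   + U_(fvar n (inord 1)) *+ (j - i - k.*2)
   + U_(fvar n (inord 2)) *+ (n - j + k))%MM.

(** On the diagonal i = j the value is 1 instead of L(0, 0) = 2, as in [quad_coef]. *)
Definition res_abscoef (t : idx) : nat :=
  let: (i, j, k) := t in if (j - i)%N is d.+1 then lucas_num d.+1 k else 1%N.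

(** The first sign comes from the Lucas expansion, the second from s = -f_1. *)
Definition res_coef (t : idx) : int :=
  let: (i, j, k) := t in
  (-1) ^+ k * (-1) ^+ (j - i - k.*2) * (res_abscoef t)%:R.

Definition res_index (t : idx) : bool :=
  let: (i, j, k) := t in (i <= j)%N && (k.*2 <= j - i)%N.

Lemma norm_res_coef t : `|res_coef t| = (res_abscoef t)%:R.
Proof.
case: t => [[i j] k]; rewrite /res_coef !normrM !normrX !normrN1 !expr1n.
by rewrite !mul1r normr_nat.
Qed.

(** The exponents of the g variables give the multiset {i, j}, ordered by i <= j; the exponent i + k
    of f_0 then gives k. *)
Lemma res_monom_inj : {in res_index &, injective res_monom}.
Proof.
move=> [[i j] k] [[i' j'] k'] /andP[ij h] /andP[ij' h'] /mnmP E.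
have eqg (s t : 'I_n.+1) : (gvar s == gvar t) = (s == t :> nat).
  by rewrite (inj_eq (@rshift_inj _ _)).
have neg (s : 'I_3) (t : 'I_n.+1) : (fvar n s == gvar t) = false.
  by rewrite /fvar /gvar eq_lrshift.
have neg' (s : 'I_3) (t : 'I_n.+1) : (gvar t == fvar n s) = false.
  by rewrite eq_sym.
have eqf (s t : nat) : (s < 3)%N -> (t < 3)%N ->
    (fvar n (inord s) == fvar n (inord t)) = (s == t).
  by move=> s3 t3; rewrite (inj_eq (@lshift_inj _ _)) -val_eqE /= !inordK.
have Eg l := E (gvar l).
have {}Eg (l : 'I_n.+1) :
    ((i == l :> nat) + (j == l :> nat) = (i' == l :> nat) + (j' == l :> nat))%N.
  have := Eg l; rewrite /= !mnmDE !mulmnE !mnm1E !neg !eqg.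
  by rewrite !mul0n !addn0.
have Ef := E (fvar n (inord 0)).
have {}Ef : (i + k = i' + k')%N.
  move: Ef; rewrite /= !mnmDE !mulmnE !mnm1E !neg' !eqf //=.
  by rewrite !mul0n !mul1n !addn0 !add0n.
have := (Eg i, Eg j, Eg i', Eg j') => -[[[]]].
rewrite !eqxx => e1 e2 e3 e4.
have [ii jj] : (i = i' :> nat) /\ (j = j' :> nat) by lia.
have kk : k = k' :> nat by lia.
by rewrite (val_inj ii) (val_inj jj) (val_inj kk).
Qed.

Lemma coef_generic_f i : (i < 3)%N -> (generic_f n)`_i = 'X_(fvar n (inord i)).
Proof.
move=> i3; rewrite -{1}(inordK i3) /generic_f.
have := @coef_sum_ord _ _ setT (fun j => 'X_(fvar n j) : mpolyZ) (inord i).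
by rewrite (eq_bigl predT) ?in_setT // => j; rewrite in_setT.
Qed.

(** The set S of surviving g_j lets one expansion serve both the generic g and the binomial. *)
Lemma resultant_monom (S : {set 'I_n.+1}) (q : {poly mpolyZ}) :
  size q = n.+1 -> q = \sum_(j in S) 'X_(gvar j) *: 'X^j ->
  resultant (generic_f n) q =
  \sum_(t | res_index t && ((t.1.1 \in S) && (t.1.2 \in S)))
    res_coef t *: 'X_[res_monom t].
Proof.
move=> sq qE; have X0 (i : 'I_3) : 'X_(fvar n i) != 0 :> mpolyZ.
  by rewrite -msupp_eq0 msuppX.
rewrite (@resultant_quad _ n) ?size_generic_f ?coef_generic_f ?X0 //.
rewrite [RHS]big_mkcondr /= pair_big_dep /=.
transitivity (\sum_(p : 'I_n.+1 * 'I_n.+1 | (p.1 <= p.2)%N)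
    \sum_(k < n.+1 | (k.*2 <= p.2 - p.1)%N)
      if (p.1 \in S) && (p.2 \in S) then
        res_coef (p, k) *: 'X_[res_monom (p, k)] else 0 : mpolyZ); last first.
  by rewrite pair_big_dep /=; apply: eq_big => [[[i j] k]|[[i j] k]].
apply: eq_bigr => -[i j]; rewrite [(_, _).1]/= [(_, _).2]/= => ij.
rewrite qE !coef_sum_ord.
case: (i \in S); last by rewrite !mul0r big1.
case: (j \in S); last by rewrite mulr0 mul0r big1.
set a : mpolyZ := 'X_(fvar n (inord 0)).
pose b : mpolyZ := 'X_(fvar n (inord 1)).
set c : mpolyZ := 'X_(fvar n (inord 2)).
have -> : quad_coef (generic_f n) (j - i) =
   \sum_(k < n.+1 | (k.*2 <= j - i)%N)
    (-1) ^+ k * (res_abscoef (i, j, k))%:R * (a * c) ^+ k * (- b) ^+ (j - i - k.*2).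
  rewrite /quad_coef /res_abscoef !coef_generic_f //.
  case dE : (j - i)%N => [|d].
    (* For i = j the condition 2k <= 0 leaves only k = 0. *)
    rewrite (big_pred1 ord0) => [|k]; first by rewrite /= !mulr1.
    by rewrite /= -val_eqE /=; case: (nat_of_ord k).
  by apply: lucas_seq_expand; move: (ltn_ord j); lia.
rewrite !mulr_sumr; apply: eq_bigr => k _.
rewrite -mul_mpolyC /res_coef !rmorphM !rmorphXn !rmorphN1 rmorph_nat.
rewrite /res_monom !mpolyXD -!mpolyXn -/a -/b -/c.
by rewrite [(- b) ^+ _]exprNn exprMn !exprD; ring.
Qed.

End Monomials.

(** * The largest coefficient of the resultant *)

Section Heights.
Variables (R : archiRcfType) (n : nat) (hn : (3 <= n)%N).
Local Notation A := (A_ R hn).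

Definition res_main : 'I_n.+1 * 'I_n.+1 * 'I_n.+1 := (ord0, ord_max, inord A).

Lemma inord_A : (inord A : 'I_n.+1) = A :> nat.
Proof. by rewrite inordK //; have := A_double_le R hn; lia. Qed.

Lemma res_main_index : res_index res_main.
Proof. by rewrite /= inord_A subn0 A_double_le. Qed.

Lemma res_monom_main : res_monom res_main = main_monom n A.
Proof. by rewrite /res_monom /res_main inord_A subn0 subnn !add0n. Qed.

Lemma res_abscoef_main : res_abscoef res_main = lucas_num n A.
Proof. by rewrite /res_abscoef /res_main inord_A subn0; case: n hn. Qed.

(** For i < j, L(j - i, k) <= L(n, k) <= L(n, A) by growth in the first index, then maximality in
    the second. *)
Lemma res_abscoef_le t : (@res_abscoef n t <= lucas_num n A)%N.
Proof.
case: t => [[i j] k]; rewrite /res_abscoef; case dE: (j - i)%N => [|d].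
  (* A square g_i^2 has coefficient 1 = L(n, 0), which the maximum also bounds. *)
  have <- : lucas_num n 0 = 1%N; last exact: lucas_num_max.
  case: n hn => // m _; clear; elim: m => // m IH.
  by rewrite lucas_numSS addn0 IH.
apply: leq_trans (lucas_num_max R hn k).
by apply: leq_lucas_num; move: (ltn_ord j) dE; lia.
Qed.

Section Support.
Variables (S : {set 'I_n.+1}) (q : {poly {mpoly int[3 + n.+1]}}).
Hypotheses (S0 : ord0 \in S) (Smax : ord_max \in S).
Hypotheses (sq : size q = n.+1) (qE : q = \sum_(j in S) 'X_(gvar j) *: 'X^j).

Let supp := [pred t | res_index t & (t.1.1 \in S) && (t.1.2 \in S)].

Let supp_inj : {in supp &, injective (@res_monom n)}.
Proof. by move=> s t /andP[sI _] /andP[tI _]; apply: res_monom_inj. Qed.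

Let supp_main : supp res_main.
Proof. by rewrite /supp inE res_main_index S0 Smax. Qed.

Let coef_le t : supp t -> `|res_coef t| <= (lucas_num n A)%:R.
Proof. by move=> _; rewrite norm_res_coef ler_nat res_abscoef_le. Qed.

Lemma mcoeff_resultant_le u :
  `|(resultant (generic_f n) q)@_u| <= (lucas_num n A)%:R.
Proof.
rewrite (resultant_monom sq qE).
exact: (mcoeff_sum_monom_le supp_inj (ler0n _ _) coef_le).
Qed.

Lemma mcoeff_resultant_main :
  `|(resultant (generic_f n) q)@_(main_monom n A)| = (lucas_num n A)%:R.
Proof.
rewrite (resultant_monom sq qE) -res_monom_main.
by rewrite (mcoeff_sum_monom _ supp_inj supp_main) norm_res_coef res_abscoef_main.
Qed.

Lemma height_resultant : height (resultant (generic_f n) q) = (lucas_num n A)%:R.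
Proof.
rewrite (resultant_monom sq qE).
apply: (height_sum_monom supp_inj (ler0n _ _) coef_le supp_main).
by rewrite norm_res_coef res_abscoef_main.
Qed.

End Support.

End Heights.

Theorem theorem1p1 (R : archiRcfType) (n : nat) (hn : (3 <= n)%N) :
  let A := A_ R hn in
  [/\ forall u : 'X_{1..3 + n.+1},
        `|(res_f_g n)@_u| <= `|(res_f_g n)@_(main_monom n A)|,
      height (res_f_g n) = height (res_f_g_binomial n) &
      (height (res_f_g_binomial n))%:~R =
        n%:R * ((n - A - 1)`!%:R / ((n - A.*2)`!%:R * A`!%:R)) :> rat].
Proof.
move=> A.
have gE : generic_g n = \sum_(j in setT) 'X_(gvar j) *: 'X^j.
  by apply: eq_bigl => j; rewrite in_setT.
have bE : generic_g_binomial n =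
    \sum_(j in [set ord0; ord_max]) 'X_(gvar j) *: 'X^j.
  rewrite big_setU1 ?big_set1 /=; last by rewrite inE -val_eqE /=; lia.
  by rewrite alg_polyC.
have sb : size (generic_g_binomial n) = n.+1 by apply: size_generic_g_binomial; lia.
have H := height_resultant R hn.
(* Both supports, {0, n} and the full index set, contain 0 and n, hence the maximal term; this
   forces the two heights to agree. *)
have hb := H _ _ (set21 _ _) (set22 _ _) sb bE.
have hg := H _ _ (in_setT _) (in_setT _) (size_generic_g n) gE.
have hm := mcoeff_resultant_main R hn (in_setT _) (in_setT _) (size_generic_g n) gE.
split=> [u||].
- by rewrite /res_f_g hm (mcoeff_resultant_le R hn (size_generic_g n) gE).
- by rewrite /res_f_g hg -hb.
- by rewrite hb rmorph_nat lucas_num_closed ?A_double_le //; lia.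
Qed.
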